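(* The functor $\ell^2 \colon \mathbf{PInj} \to \mathbf{Hilb}$ preserves the order structure of homsets: if $f_i \colon X \to Y$ is a directed family of morphisms in $\mathbf{PInj}$, then $\ell^2(\bigvee_i f_i) = \bigvee_i \ell^2 f_i$.
   Context: $\mathbf{Hilb}$ is the category of complex Hilbert spaces and continuous linear functions. Its homsets are ordered by: $f \leq g$ when $\ker(f)^\perp \subseteq \ker(g)^\perp$ and $f(x) = g(x)$ for all $x \in \ker(f)^\perp$. $\mathbf{PInj}$ is the category whose objects are sets and whose morphisms $X \to Y$ are partial injections, i.e. partial functions that are injective on their domain of definition, composed as relations. Its homsets are ordered by: $f \leq g$ when the domain of definition of $f$ is contained in that of $g$ and $f(x) = g(x)$ for all $x$ in the domain of definition of $f$. Suprema $\bigvee$ are taken with respect to these orders. The functor $\ell^2 \colon \mathbf{PInj} \to \mathbf{Hilb}$ sends a set $X$ to $\ell^2(X) = \{\varphi \colon X \to \mathbb{C} \mid \sum_{x\in X} |\varphi(x)|^2 < \infty\}$ with inner product $\langle \varphi | \psi\rangle = \sum_{x \in X} \overline{\varphi(x)}\psi(x)$, and sends a partial injection $f \colon X \to Y$ to the linear map $\ell^2 f \colon \ell^2(X) \to \ell^2(Y)$ with $(\ell^2 f)(\varphi)(y) = \varphi(x)$ if there is a (necessarily unique) $x$ in the domain of definition of $f$ with $f(x) = y$, and $(\ell^2 f)(\varphi)(y) = 0$ otherwise. *)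

(* Defs.v *)
From HB Require Import structures.
From mathcomp Require Import all_boot all_order all_algebra finmap complex.
From mathcomp Require Import all_classical all_reals all_analysis.
From mathcomp Require Import ring lra.
From mathcomp Require summability.
Import Order.TTheory GRing.Theory Num.Theory numFieldNormedType.Exports.
Local Open Scope classical_set_scope.
Local Open Scope ring_scope.

Set Implicit Arguments.
Unset Strict Implicit.
Unset Printing Implicit Defensive.

Local Notation Re := complex.Re.
Local Notation Im := complex.Im.

Section ComplexTopology.
Variable R : realType.
Local Open Scope complex_scope.
Local Notation C := (R[i]^o).

Lemma norm_real_complex (x : R) : `|x%:C| = `|x|%:C.
Proof. by rewrite normc_def /= expr0n addr0 sqrtr_sqr. Qed.

Lemma ge_norm_Re (z : R[i]) : `|Re z|%:C <= `|z|.
Proof. exact: normc_ge_Re. Qed.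

Lemma ge_norm_Im (z : R[i]) : `|Im z|%:C <= `|z|.
Proof.
case: z => a b; rewrite normc_def lecR -sqrtr_sqr ler_sqrt ?lerDr ?sqr_ge0 //=.
by rewrite addr_ge0 ?sqr_ge0.
Qed.

Lemma le_norm_ReIm (z : R[i]) : `|z| <= (`|Re z| + `|Im z|)%:C.
Proof.
rewrite {1}(complexE z) (le_trans (ler_normD _ _))// normrM !norm_real_complex.
rewrite rmorphD lerD2l [X in X * _](_ : _ = 1) ?mul1r//.
by rewrite normc_def /= expr0n expr1n add0r sqrtr1.
Qed.

Lemma complex_gt0P (e : R[i]) : 0 < e -> exists2 r : R, 0 < r & e = r%:C.
Proof. by case: e => a b; rewrite ltcE /= => /andP[/eqP-> ?]; exists a. Qed.

Lemma cvg_ReIm (T : Type) (F : set_system T) (FF : Filter F) (f : T -> C)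
    (l : C) :
  (Re (f t) @[t --> F] --> Re l) -> (Im (f t) @[t --> F] --> Im l) ->
  f @ F --> l.
Proof.
move=> fr fi; apply/cvgrPdist_lt => _ /complex_gt0P[e e0 ->].
have e20 : 0 < e / 2 by rewrite divr_gt0.
move/cvgrPdist_lt : fr => /(_ _ e20) fr; move/cvgrPdist_lt : fi => /(_ _ e20) fi.
near=> t; apply: (le_lt_trans (le_norm_ReIm _)).
rewrite ltcR (splitr e) !raddfB /= ltrD//.
- by near: t.
- by near: t.
Unshelve. all: by end_near. Qed.

Lemma cvg_Re (T : Type) (F : set_system T) (FF : Filter F) (f : T -> C)
    (l : C) : f @ F --> l -> Re (f t) @[t --> F] --> Re l.
Proof.
move=> fl; apply/cvgrPdist_lt => e e0.
have e0C : 0 < (e%:C : R[i]) by rewrite ltcR.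
move/cvgrPdist_lt : fl => /(_ _ e0C); apply: filterS => t.
by rewrite -raddfB -ltcR; apply: le_lt_trans; exact: ge_norm_Re.
Qed.

Lemma cvg_Im (T : Type) (F : set_system T) (FF : Filter F) (f : T -> C)
    (l : C) : f @ F --> l -> Im (f t) @[t --> F] --> Im l.
Proof.
move=> fl; apply/cvgrPdist_lt => e e0.
have e0C : 0 < (e%:C : R[i]) by rewrite ltcR.
move/cvgrPdist_lt : fl => /(_ _ e0C); apply: filterS => t.
by rewrite -raddfB -ltcR; apply: le_lt_trans; exact: ge_norm_Im.
Qed.

Lemma complex_complete (F : set_system C) :
  ProperFilter F -> cauchy_ex F -> cvg F.
Proof.
move=> FF Fc.
have Hr : cvg (@complex.Re R @ F).
  apply: cauchy_cvg; apply: cauchy_exP => e e0.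
  have e0C : 0 < (e%:C : R[i]) by rewrite ltcR.
  have [x Fx] := Fc _ e0C; exists (Re x); move: Fx; apply: (@filterS _ F) => y.
  rewrite -!ball_normE/= -raddfB -ltcR; apply: le_lt_trans; exact: ge_norm_Re.
have Hi : cvg (@complex.Im R @ F).
  apply: cauchy_cvg; apply: cauchy_exP => e e0.
  have e0C : 0 < (e%:C : R[i]) by rewrite ltcR.
  have [x Fx] := Fc _ e0C; exists (Im x); move: Fx; apply: (@filterS _ F) => y.
  rewrite -!ball_normE/= -raddfB -ltcR; apply: le_lt_trans; exact: ge_norm_Im.
apply/cvg_ex; exists (lim (@complex.Re R @ F) +i* lim (@complex.Im R @ F)).
exact: (@cvg_ReIm C F _ id).
Qed.

End ComplexTopology.

Section UnconditionalSum.
Variables (R : realType) (X : Type).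
Local Open Scope complex_scope.
#[local] Existing Instance summability.totally_filter.
Implicit Types (u v : {classic X} -> R[i]) (g : {classic X} -> R).

(* The unconditional sum: the limit of the finite partial sums along the
   directed set of finite subsets of X; [{classic X}] is X itself, endowed with
   a choice structure. *)
Definition csum u : R[i] := summability.sum (u : {classic X} -> R[i]^o).

Local Notation S u A := (\sum_(x <- enum_fset A) u x).
Local Notation totally := (@summability.totally {classic X}).

Definition bounded_sums g := exists M, forall A : {fset {classic X}}, S g A <= M.

Lemma csumE u : csum u = lim ((S u A : R[i]^o) @[A --> totally]).
Proof.
rewrite /csum /summability.sum.
suff -> : summability.partial_sum (u : _ -> R[i]^o) =
  (fun A : {fset {classic X}} => S u A) by [].
by apply/funext => A; symmetry; exact: (big_seq_fsetE _ A xpredT u).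
Qed.

Lemma sum_fsetD (V : nmodType) (h : {classic X} -> V)
    (A B : {fset {classic X}}) :
  (A `<=` B)%fset -> S h B = S h A + S h (B `\` A)%fset.
Proof.
move=> /fsubsetP AB; rewrite -big_cat; apply: perm_big.
apply: uniq_perm => //.
  rewrite cat_uniq !fset_uniq /= andbT; apply/hasPn => x.
  by rewrite in_fsetD => /andP[].
move=> x; rewrite mem_cat in_fsetD.
by case: (boolP (x \in A)) => //= /AB ->.
Qed.

Lemma cvg_csum u : bounded_sums (fun x => Normc.normc (u x)) ->
  ((S u A : R[i]^o) @[A --> totally]) --> (csum u : R[i]^o).
Proof.
move=> [M uM]; rewrite csumE; apply: complex_complete => e /complex_gt0P[r r0 ->].
pose E := [set S (fun x => Normc.normc (u x)) A | A in [set: {fset {classic X}}]].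
have supE : has_sup E.
  split; first by exists (S (fun x => Normc.normc (u x)) fset0); exists fset0.
  by exists M => _ [A _ <-].
have [_ [A _ <-]] := sup_adherent r0 supE; rewrite ltrBlDr => supA.
exists (S u A); exists A => //= B /= AB.
rewrite -ball_normE /= (sum_fsetD _ AB) opprD addNKr normrN.
rewrite (le_lt_trans (ler_norm_sum _ _ _))//.
have : S (fun x => Normc.normc (u x)) B < S (fun x => Normc.normc (u x)) A + r.
  apply: le_lt_trans supA; apply: sup_upper_bound => //; by exists B.
rewrite (sum_fsetD _ AB) ltrD2l -ltcR rmorph_sum /=.
by [].
Qed.

End UnconditionalSum.

Section UnconditionalSumTheory.
Variables (R : realType) (X : Type).
Local Open Scope complex_scope.
#[local] Existing Instance summability.totally_filter.
Implicit Types (u v : {classic X} -> R[i]) (g : {classic X} -> R).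

Local Notation S u A := (\sum_(x <- enum_fset A) u x).
Local Notation totally := (@summability.totally {classic X}).

Lemma bounded_sums_le (g h : {classic X} -> R) :
  (forall x, g x <= h x) -> bounded_sums h -> bounded_sums g.
Proof.
move=> gh [M hM]; exists M => A; apply: le_trans (hM A).
by apply: ler_sum => x _.
Qed.

Lemma bounded_sumsD (g h : {classic X} -> R) :
  bounded_sums g -> bounded_sums h -> bounded_sums (fun x => g x + h x).
Proof.
move=> [M gM] [N hN]; exists (M + N) => A.
by rewrite big_split lerD.
Qed.

Lemma bounded_sumsZ (a : R) g :
  0 <= a -> bounded_sums g -> bounded_sums (fun x => a * g x).
Proof.
by move=> a0 [M gM]; exists (a * M) => A; rewrite -mulr_sumr ler_wpM2l.
Qed.

Lemma csum_lim u (l : R[i]) :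
  ((S u A : R[i]^o) @[A --> totally]) --> (l : R[i]^o) -> csum u = l.
Proof. by move=> ul; rewrite csumE; apply: cvg_lim ul; exact: norm_hausdorff. Qed.

Lemma csumP (a : R[i]) u v :
  bounded_sums (fun x => Normc.normc (u x)) ->
  bounded_sums (fun x => Normc.normc (v x)) ->
  csum (fun x => a * u x + v x) = a * csum u + csum v.
Proof.
move=> /cvg_csum uc /cvg_csum vc; apply: csum_lim.
under eq_cvg do rewrite big_split /= -mulr_sumr.
have FF : Filter totally by exact: filter_filter.
have au := @cvgMl_tmp _ _ _ FF _ a _ uc.
have auv := @cvgD _ _ _ _ FF _ _ _ _ au vc.
exact: auv.
Qed.

Lemma csum_conj u : bounded_sums (fun x => Normc.normc (u x)) ->
  csum (fun x => Num.conj (u x)) = Num.conj (csum u).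
Proof.
move=> /cvg_csum uc; apply: csum_lim; apply/cvgrPdist_lt => e e0.
move/cvgrPdist_lt : uc => /(_ _ e0); apply: filterS => A.
by rewrite -rmorph_sum -rmorphB norm_conjC.
Qed.

Lemma csum_ge0P g : (forall x, 0 <= g x) -> bounded_sums g ->
  exists s : R, [/\ csum (fun x => (g x)%:C) = s%:C,
    forall A : {fset {classic X}}, S g A <= s &
    forall M, (forall A : {fset {classic X}}, S g A <= M) -> s <= M].
Proof.
move=> g0 gb.
have SE (A : {fset {classic X}}) : S (fun x => (g x)%:C) A = (S g A)%:C.
  by rewrite rmorph_sum.
have gc : (((S g A)%:C : R[i]^o) @[A --> totally]) -->
    (csum (fun x => (g x)%:C) : R[i]^o).
  under eq_cvg do rewrite -SE.
  apply: cvg_csum; apply: bounded_sums_le gb => x.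
  by rewrite /= expr0n addr0 sqrtr_sqr ger0_norm.
have FF : Filter totally by exact: filter_filter.
have rl := cvg_Re FF gc; have il := cvg_Im FF gc.
rewrite /= in rl il; set l := csum _ in rl il *.
exists (Re l); split.
- have : Im l = 0 by rewrite -(cvg_lim (@Rhausdorff R) il) lim_cst.
  by case: (l) => a b /= ->.
- move=> A; apply: cvgr_to_ge rl _; exists A => //= B /= AB.
  by rewrite (sum_fsetD _ AB) lerDl sumr_ge0.
- by move=> M gM; apply: cvgr_to_le rl _; exists fset0 => //= B _.
Qed.

End UnconditionalSumTheory.

Section SquareSummable.
Variables (R : realType) (X : Type).
Local Open Scope complex_scope.

Definition square_summable : {pred X -> R[i]^o} := [pred phi : X -> R[i]^o |
  (\esum_(x in [set: {classic X}]) (Normc.normc (phi x) ^+ 2)%:E < +oo)%E].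

Lemma square_summableP (phi : X -> R[i]) : reflect
  (bounded_sums (fun x : {classic X} => Normc.normc (phi x) ^+ 2))
  (phi \in square_summable).
Proof.
pose q (x : {classic X}) := Normc.normc (phi x) ^+ 2.
have qE (A : {fset {classic X}}) :
    (\sum_(x <- enum_fset A) q x)%:E = (\sum_(x \in [set` A]) (q x)%:E)%E.
  by rewrite fsbig_finite// set_fsetK sumEFin.
apply: (iffP idP) => [phioo|[M phiM]].
- have phifin : \esum_(x in [set: {classic X}]) (q x)%:E \is a fin_num.
    by rewrite ge0_fin_numE// esum_ge0// => x _; rewrite lee_fin sqr_ge0.
  exists (fine (\esum_(x in [set: {classic X}]) (q x)%:E)) => A.
  rewrite -lee_fin fineK// qE; apply: esum_ge; exists [set` A] => //.
- rewrite unfold_in /=; apply: (@le_lt_trans _ _ M%:E); last by rewrite ltry.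
  apply: ge_ereal_sup => _ [A [Afin _] <-].
  have {1}-> : A = [set` fset_set A] by rewrite fset_setK.
  by rewrite -qE lee_fin; exact: phiM.
Qed.

Lemma normcZD (a y z : R[i]) : Normc.normc (a * y + z) ^+ 2 <=
  2 * Normc.normc a ^+ 2 * Normc.normc y ^+ 2 + 2 * Normc.normc z ^+ 2.
Proof.
have normc_ge0 (w : R[i]) : 0 <= Normc.normc w.
  by case: w => ? ?; exact: sqrtr_ge0.
have le_sq : Normc.normc (a * y + z) <=
    Normc.normc a * Normc.normc y + Normc.normc z.
  by rewrite -Normc.normcM; exact: le_normcD.
have := normc_ge0 (a * y + z); move: le_sq.
move: (Normc.normc (a * y + z)) (Normc.normc a) (Normc.normc y) (Normc.normc z).
move=> t p q r tpqr t0; apply: (@le_trans _ _ ((p * q + r) ^+ 2)).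
  by rewrite ler_sqr ?nnegrE// (le_trans t0).
by rewrite -subr_ge0 (_ : _ - _ = (p * q - r) ^+ 2) ?sqr_ge0//; ring.
Qed.

Lemma square_summable_submod_closed : submod_closed square_summable.
Proof.
split=> [|a u v /square_summableP uP /square_summableP vP].
  apply/square_summableP; exists 0 => A; rewrite big1// => x _.
  by rewrite Normc.normc0 expr0n.
apply/square_summableP; apply: bounded_sums_le (fun x => normcZD a (u x) (v x)) _.
by apply: bounded_sumsD; apply: bounded_sumsZ => //; rewrite mulr_ge0 ?sqr_ge0.
Qed.

HB.instance Definition _ := GRing.isSubmodClosed.Build R[i] (X -> R[i]^o)
  square_summable square_summable_submod_closed.

Record l2 := L2 { l2_fun :> X -> R[i]^o; l2_funP : l2_fun \in square_summable }.

HB.instance Definition _ := [isSub for l2_fun].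
HB.instance Definition _ := [Choice of l2 by <:].
HB.instance Definition _ := [SubChoice_isSubLmodule of l2 by <:].

End SquareSummable.

Section L2Dot.
Variables (R : realType) (X : Type).
Local Open Scope complex_scope.
Implicit Types u v w : l2 R X.

Lemma l2_bounded_sums u :
  bounded_sums (fun x : {classic X} => Normc.normc (u x) ^+ 2).
Proof. by apply/square_summableP; exact: l2_funP. Qed.

Lemma normc_conj (z : R[i]) : Normc.normc (Num.conj z) = Normc.normc z.
Proof. by case: z => a b; rewrite /= sqrrN. Qed.

Lemma l2_bounded_dot u v :
  bounded_sums (fun x : {classic X} => Normc.normc (u x * Num.conj (v x))).
Proof.
apply: bounded_sums_le (bounded_sumsD (l2_bounded_sums u) (l2_bounded_sums v)).
move=> x; rewrite Normc.normcM normc_conj.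
move: (Normc.normc (u x)) (Normc.normc (v x)) => p q; nra.
Qed.

(* The library's dot products are linear in the first argument and semilinear
   in the second one; see [inner] and [l2_innerE] below for the opposite
   convention. *)
Definition l2_dot u v : R[i] :=
  csum (fun x : {classic X} => u x * Num.conj (v x)).

Lemma l2_dotP_l (a : R[i]) u v w :
  l2_dot (a *: u + v) w = a * l2_dot u w + l2_dot v w.
Proof.
rewrite /l2_dot -csumP; [|exact: l2_bounded_dot..].
by congr csum; apply/funext => x; rewrite mulrA -mulrDl.
Qed.

Lemma l2_dotC u v : l2_dot u v = Num.conj (l2_dot v u).
Proof.
rewrite /l2_dot -csum_conj; last exact: l2_bounded_dot.
by congr csum; apply/funext => x; rewrite rmorphM /= conjCK mulrC.
Qed.

Lemma l2_dotP_r (a : R[i]) u v w :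
  l2_dot w (a *: u + v) = Num.conj a * l2_dot w u + l2_dot w v.
Proof.
by rewrite l2_dotC l2_dotP_l rmorphD rmorphM /= -!(l2_dotC w).
Qed.

Lemma l2_dot0l w : l2_dot 0 w = 0.
Proof.
have := l2_dotP_l 1 0 0 w; rewrite scaler0 addr0 mul1r => /eqP.
by rewrite -subr_eq subrr => /eqP.
Qed.

Lemma l2_dot0r w : l2_dot w 0 = 0.
Proof. by rewrite l2_dotC l2_dot0l rmorph0. Qed.

Lemma l2_dot_normE u : exists s : R, [/\ l2_dot u u = s%:C,
    forall A : {fset {classic X}},
      \sum_(x <- enum_fset A) Normc.normc (u x) ^+ 2 <= s &
    forall M, (forall A : {fset {classic X}},
      \sum_(x <- enum_fset A) Normc.normc (u x) ^+ 2 <= M) -> s <= M].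
Proof.
have [|s [sE sge sle]] := csum_ge0P _ (l2_bounded_sums u).
  by move=> x; exact: sqr_ge0.
exists s; split => //; rewrite -sE; congr csum; apply/funext => x.
by rewrite -normCK rmorphXn.
Qed.

Lemma l2_dot_gt0 u : u != 0 -> 0 < l2_dot u u.
Proof.
have [s [-> sge _]] := l2_dot_normE u.
rewrite ltcR => u0.
have [x ux0] : exists x, u x != 0.
  apply: contrapT => /forallNP ux0; case/eqP: u0; apply/val_inj/funext => x.
  by have /negP := ux0 x; rewrite negbK => /eqP.
apply: lt_le_trans (sge [fset (x : {classic X})]%fset).
rewrite big_seq_fset1 exprn_gt0// lt_def; apply/andP; split.
  by apply: contra ux0 => /eqP/Normc.eq0_normc ->.
by case: (u x) => ? ?; exact: sqrtr_ge0.
Qed.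

Fact l2_dot_zmodl v : zmod_morphism (l2_dot ^~ v).
Proof.
by move=> x y /=; rewrite addrC -scaleN1r l2_dotP_l mulN1r addrC.
Qed.

Fact l2_dot_zmodr u : zmod_morphism (l2_dot u).
Proof.
by move=> x y /=; rewrite addrC -scaleN1r l2_dotP_r rmorphN1 mulN1r addrC.
Qed.

Fact l2_dot_scalel v : scalable_for *%R (l2_dot ^~ v).
Proof.
by move=> a x /=; rewrite -[a *: x]addr0 l2_dotP_l l2_dot0l addr0.
Qed.

Fact l2_dot_scaler u :
  scalable_for ((@Num.conj R[i] : R[i] -> R[i]) \; *%R) (l2_dot u).
Proof.
by move=> a x /=; rewrite -[a *: x]addr0 l2_dotP_r l2_dot0r addr0.
Qed.

HB.instance Definition _ := isBilinear.Build R[i] (l2 R X) (l2 R X) R[i]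
  *%R ((@Num.conj R[i] : R[i] -> R[i]) \; *%R) l2_dot
  l2_dot_zmodl l2_dot_zmodr l2_dot_scalel l2_dot_scaler.

Fact l2_dot_herm u v : l2_dot u v = (-1) ^+ false * Num.conj (l2_dot v u).
Proof. by rewrite mul1r -l2_dotC. Qed.

HB.instance Definition _ := isHermitianSesquilinear.Build R[i] (l2 R X) false
  (@Num.conj R[i]) l2_dot l2_dot_herm.
HB.instance Definition _ := isDotProduct.Build R[i] (l2 R X) l2_dot l2_dot_gt0.

End L2Dot.

Lemma sqrt_dnormD (C : numClosedFieldType) (U : lmodType C)
    (form : {dot U for (@Num.conj C)}) (u v : U) :
  sqrtC (form (u + v) (u + v)) <= sqrtC (form u u) + sqrtC (form v v).
Proof.
have [->|u0] := eqVneq u 0.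
  by rewrite add0r linear0r sqrtC0 add0r.
have [->|v0] := eqVneq v 0.
  by rewrite addr0 linear0r sqrtC0 addr0.
have p0 : 0 < sqrtC (form u u) by rewrite sqrt_dnorm_gt0.
have q0 : 0 < sqrtC (form v v) by rewrite sqrt_dnorm_gt0.
have pq0 : 0 < sqrtC (form u u) * sqrtC (form v v) by rewrite mulr_gt0.
rewrite -ler_sqr ?nnegrE ?addr_ge0 ?sqrt_dnorm_ge0//.
rewrite sqrrD !sqrtCK dnormD [X in _ <= X]addrAC lerD2l -(ler_pM2l pq0).
set p := sqrtC (form u u) in p0 pq0 *; set q := sqrtC (form v v) in q0 pq0 *.
have pC : Num.conj p = p by rewrite geC0_conj// ltW.
have qC : Num.conj q = q by rewrite geC0_conj// ltW.
have dE : form (q *: u) (p *: v) = p * q * form u v.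
  by rewrite linearZl_LR linearZr_LR /= pC mulrA [q * p]mulrC.
have := dnorm_ge0 form (q *: u - p *: v).
rewrite dnormB (dnormZ form q u) (dnormZ form p v) dE rmorphM rmorphM /= pC qC.
rewrite !ger0_norm ?(ltW p0) ?(ltW q0)// -subr_ge0.
rewrite -[form u u]sqrtCK -[form v v]sqrtCK -/p -/q => /le_trans; apply.
by rewrite le_eqVlt; apply/orP; left; apply/eqP; ring.
Qed.

HB.mixin Record CompleteNormedModule_isHilbert (R : realType) H
    of CompleteNormedModule R[i] H := {
  dotp : {dot H for (@Num.conj R[i])} ;
  sqr_norm_dotp : forall u : H, `|u| ^+ 2 = dotp u u }.

#[short(type="hilbertType")]
HB.structure Definition Hilbert (R : realType) :=
  {H of CompleteNormedModule R[i] H & CompleteNormedModule_isHilbert R H}.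

Section L2Norm.
Variables (R : realType) (X : Type).
Local Open Scope complex_scope.
Implicit Types u v w : l2 R X.

Definition l2_norm u : R[i] := sqrtC (l2_dot u u).

Fact l2_normD u v : l2_norm (u + v) <= l2_norm u + l2_norm v.
Proof. exact: (sqrt_dnormD (@l2_dot R X : {dot _ for _})). Qed.

Fact l2_normZ (a : R[i]) u : l2_norm (a *: u) = `|a| * l2_norm u.
Proof.
rewrite /l2_norm (dnormZ (@l2_dot R X : {dot _ for _})).
by rewrite sqrtCM ?nnegrE ?exprn_ge0 ?sqrCK ?dnorm_ge0.
Qed.

Fact l2_norm_eq0 u : l2_norm u = 0 -> u = 0.
Proof.
by move=> /eqP; rewrite (sqrt_dnorm_eq0 (@l2_dot R X : {dot _ for _})) => /eqP.
Qed.

HB.instance Definition _ :=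
  Lmodule_isNormed.Build R[i] (l2 R X) l2_normD l2_normZ l2_norm_eq0.

Fact l2_sqr_norm u : `|u| ^+ 2 = l2_dot u u.
Proof. exact: sqrtCK. Qed.

Lemma le_l2_norm u (r : R) : 0 <= r -> `|u| <= r%:C <->
  forall A : {fset {classic X}},
    \sum_(x <- enum_fset A) Normc.normc (u x) ^+ 2 <= r ^+ 2.
Proof.
move=> r0; have [s [sE sge sle]] := l2_dot_normE u.
rewrite -ler_sqr ?nnegrE ?normr_ge0 ?ler0c// l2_sqr_norm sE -rmorphXn lecR.
by split=> [sr A|/sle//]; exact: le_trans (sge A) sr.
Qed.

Lemma l2_norm_coord u x : `|u x| <= `|u|.
Proof.
have [s [sE sge _]] := l2_dot_normE u.
rewrite -ler_sqr ?nnegrE ?normr_ge0// l2_sqr_norm sE.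
have := sge [fset (x : {classic X})]%fset; rewrite big_seq_fset1 -lecR rmorphXn.
by [].
Qed.

Lemma sqr_normc_ReIm (z : R[i]) : Normc.normc z ^+ 2 = Re z ^+ 2 + Im z ^+ 2.
Proof. by case: z => a b; rewrite sqr_sqrtr// addr_ge0 ?sqr_ge0. Qed.

Lemma cvg_sqr_normc (T : Type) (F : set_system T) (FF : Filter F)
    (f : T -> R[i]^o) (l : R[i]^o) : f @ F --> l ->
  Normc.normc (f t) ^+ 2 @[t --> F] --> Normc.normc l ^+ 2.
Proof.
move=> fl; rewrite sqr_normc_ReIm; under eq_cvg do rewrite sqr_normc_ReIm.
have fr := cvg_Re FF fl; have fi := cvg_Im FF fl.
by apply: cvgD; rewrite expr2; apply: cvgM.
Qed.

Fact l2_complete (F : set_system (l2 R X)) : ProperFilter F -> cauchy F -> cvg F.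
Proof.
move=> FF /cauchyP Fc.
have FFF : Filter F by exact: filter_filter.
have cvgx x : cvg ((fun u : l2 R X => u x : R[i]^o) @ F).
  apply: complex_complete => e e0; have [w Fw] := Fc _ e0.
  exists (w x); move: Fw; apply: (@filterS _ F) => u.
  rewrite -!ball_normE /= ; apply: le_lt_trans.
  exact: (l2_norm_coord (w - u) x).
pose phi x : R[i]^o := lim ((fun u : l2 R X => u x : R[i]^o) @ F).
have near_phi (r : R) : 0 < r -> F [set u : l2 R X |
      forall A : {fset {classic X}},
        \sum_(x <- enum_fset A) Normc.normc (phi x - u x) ^+ 2 <= r ^+ 2].
  move=> r0; have r20 : 0 < ((r / 2)%:C : R[i]) by rewrite ltcR divr_gt0.
  have [w Fw] := Fc _ r20; move: (Fw); apply: (@filterS _ F) => u wu A.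
  have lim_sum (s : seq {classic X}) :
      (fun v : l2 R X => \sum_(x <- s) Normc.normc (v x - u x) ^+ 2) @ F -->
      \sum_(x <- s) Normc.normc (phi x - u x) ^+ 2.
    elim: s => [|x s IHs].
      by rewrite big_nil; under eq_cvg do rewrite big_nil; exact: cvg_cst.
    rewrite big_cons; under eq_cvg do rewrite big_cons.
    apply: cvgD IHs; apply: (cvg_sqr_normc FFF).
    apply: (@cvgB _ R[i]^o); last exact: cvg_cst.
    exact: cvgx.
  apply: (cvgr_to_le (lim_sum (enum_fset A))).
  move: Fw; apply: (@filterS _ F) => v wv.
  apply: (le_l2_norm (v - u) (ltW r0)).1.
  rewrite (splitr r) rmorphD -(subrKA w) (le_trans (ler_normD _ _))// lerD//.
    by move: wv; rewrite -ball_normE /= distrC => /ltW.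
  by move: wu; rewrite -ball_normE /= => /ltW.
have phi_l2 : phi \in @square_summable R X.
  have [u u1] := filter_ex (near_phi 1 ltr01).
  rewrite -(subrK (u : X -> R[i]^o) phi) rpredD//; last exact: l2_funP.
  by apply/square_summableP; exists (1 ^+ 2).
apply/cvg_ex; exists (L2 phi_l2); apply/cvgrPdist_le => e.
move=> /complex_gt0P[r r0 ->]; move: (near_phi r r0).
apply: (@filterS _ F) => u phiu.
by apply/le_l2_norm => //; exact: ltW.
Qed.

HB.instance Definition _ := Uniform_isComplete.Build (l2 R X) l2_complete.

HB.instance Definition _ := CompleteNormedModule_isHilbert.Build R (l2 R X)
  (l2_sqr_norm : forall u, _ = (@l2_dot R X : {dot l2 R X for (@Num.conj R[i])}) u u).
End L2Norm.

Section Supremum.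
Variable T : Type.
Implicit Types (le : T -> T -> Prop).

Definition directed le I (F : I -> T) :=
  inhabited I /\ forall i j, exists k, le (F i) (F k) /\ le (F j) (F k).

Definition is_sup le I (F : I -> T) (s : T) :=
  (forall i, le (F i) s) /\ (forall t, (forall i, le (F i) t) -> le s t).

End Supremum.

(* [f x = None] means that x is outside the domain of definition of f. *)
Record pinj (X Y : Type) := PInj {
  pinj_fun :> X -> option Y ;
  pinj_inj : forall x x' y, pinj_fun x = Some y -> pinj_fun x' = Some y -> x = x'
}.

Definition pdom X Y (f : pinj X Y) : set X := [set x | f x <> None].

Definition pinj_le {X Y} (f g : pinj X Y) :=
  pdom f `<=` pdom g /\ forall x, pdom f x -> f x = g x.

Section Hilb.
Variable R : realType.

Record hilb_hom (H K : hilbertType R) := HilbHom {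
  hilb_fun :> {linear H -> K} ;
  hilb_continuous : continuous hilb_fun
}.

(* <u|v>, antilinear in u. *)
Definition inner (H : hilbertType R) (u v : H) : R[i] := dotp v u.

Definition orthogonal_complement (H : hilbertType R) (A : set H) : set H :=
  [set u | forall v, A v -> inner u v = 0].

Definition hilb_ker (H K : hilbertType R) (f : hilb_hom H K) : set H :=
  [set u | f u = 0].

Definition hilb_le (H K : hilbertType R) (f g : hilb_hom H K) :=
  orthogonal_complement (hilb_ker f) `<=` orthogonal_complement (hilb_ker g) /\
  forall u, orthogonal_complement (hilb_ker f) u -> f u = g u.

Lemma l2_innerE (X : Type) (phi psi : l2 R X) :
  inner phi psi = csum (fun x : {classic X} => Num.conj (phi x) * psi x).
Proof. by congr csum; apply/funext => x; rewrite mulrC. Qed.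

End Hilb.
Arguments hilb_le {R H K} f g.

Section L2Map.
Variables (R : realType) (X Y : Type) (f : pinj X Y).
Local Open Scope complex_scope.

(* The preimage of y under f, unique if it exists. *)
Definition pinj_inv (y : Y) : option X :=
  if pselect (exists x, f x = Some y) is left fy then Some (sval (cid fy))
  else None.

Lemma pinj_invP x y : pinj_inv y = Some x <-> f x = Some y.
Proof.
rewrite /pinj_inv; case: pselect => [fy|nfy]; last first.
  by split=> // fxy; case: nfy; exists x.
case: cid => x' /= fx'y; split=> [[<-]//|fxy].
by rewrite (pinj_inj fxy fx'y).
Qed.

Definition l2_map_fun (phi : X -> R[i]^o) : Y -> R[i]^o :=
  fun y => if pinj_inv y is Some x then phi x else 0.

Lemma sum_l2_map_le (u : l2 R X) (M : R) :
  (forall A : {fset {classic X}},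
    \sum_(x <- enum_fset A) Normc.normc (u x) ^+ 2 <= M) ->
  forall B : {fset {classic Y}},
    \sum_(y <- enum_fset B) Normc.normc (l2_map_fun u y) ^+ 2 <= M.
Proof.
move=> uM B.
pose s := pmap (pinj_inv : {classic Y} -> option {classic X}) (enum_fset B).
have us : uniq s.
  rewrite /s; have := fset_uniq B; elim: (enum_fset B) => //= y r IHr.
  move=> /andP[yr /IHr ur]; case E : (pinj_inv y) => [x|] //=.
  rewrite ur andbT mem_pmap; apply: contra yr => /mapP[y' y'r E'].
  have /pinj_invP fxy := E; have /pinj_invP := esym E'.
  by rewrite fxy => -[->].
suff -> : \sum_(y <- enum_fset B) Normc.normc (l2_map_fun u y) ^+ 2 =
    \sum_(x <- enum_fset [fset x in s]%fset) Normc.normc (u x) ^+ 2 by [].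
rewrite [RHS](perm_big s); last first.
  by apply: uniq_perm => [||x]; [exact: fset_uniq|exact: us|rewrite inE].
rewrite big_pmap; apply: eq_bigr => y _; rewrite /l2_map_fun.
by case: pinj_inv => [//|]; rewrite /oapp Normc.normc0 expr0n.
Qed.

Lemma l2_map_subproof (u : l2 R X) : l2_map_fun u \in @square_summable R Y.
Proof.
apply/square_summableP; have [M uM] := l2_bounded_sums u.
by exists M; exact: sum_l2_map_le.
Qed.

Definition l2_map_l2 (u : l2 R X) : l2 R Y := L2 (l2_map_subproof u).

Fact l2_map_linear : linear l2_map_l2.
Proof.
move=> a u v; apply/val_inj/funext => y /=.
rewrite -[RHS]/(a * l2_map_fun u y + l2_map_fun v y) /l2_map_fun.
by case: pinj_inv => [//|]; rewrite mulr0 addr0.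
Qed.

HB.instance Definition _ :=
  GRing.isLinear.Build R[i] (l2 R X) (l2 R Y) _ l2_map_l2 l2_map_linear.

Fact l2_map_continuous : continuous l2_map_l2.
Proof.
apply: bounded_linear_continuous; apply/linear_boundedP.
near=> r => u; apply: (@le_trans _ _ (1 * `|u|)); last first.
  by rewrite ler_wpM2r//; near: r; exact: nbhs_pinfty_ge.
rewrite mul1r; have [s s0 us] : exists2 s : R, 0 <= s & `|u| = s%:C.
  have : 0 <= `|u| by [].
  by case: `|u| => a b; rewrite lecE /= => /andP[/eqP-> ?]; exists a.
rewrite us; apply/le_l2_norm => //; apply: sum_l2_map_le.
by apply/le_l2_norm => //; rewrite us.
Unshelve. all: by end_near. Qed.

Definition l2_map : hilb_hom (l2 R X) (l2 R Y) := HilbHom l2_map_continuous.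

End L2Map.

(* Main.v *)
Require Import Defs.
From mathcomp Require Import all_boot all_order all_algebra finmap complex.
From mathcomp Require Import all_classical all_reals all_analysis.
From mathcomp Require summability.

(** The order on bounded maps compares orthogonal complements of kernels, and
    for [l2_map R f] these are easy to describe: the kernel consists of the
    vectors vanishing on the domain of [f], and its orthogonal complement of the
    vectors supported on that domain ([orthogonal_ker_l2_mapP]).  Hence [l2_map]
    is monotone ([l2_map_le]).

    A directed family of partial injections has as supremum the union of the
    graphs, and consequently each point of the domain of a supremum [s] already
    lies in the domain of some [f i] ([sup_pdom]).  Let [t] be an upper bound of
    the [l2_map R (f i)].  Every basis vector [ket x] with [x] in the domain of
    [s] is orthogonal to the kernel of some [l2_map R (f i)], hence to the kernel
    of [t], and [t] agrees there with [l2_map R (f i)], hence with [l2_map R s].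
    The first fact says that vectors in the kernel of [t] vanish on the domain of
    [s], so they are orthogonal to everything supported on that domain.  The
    second one extends, by linearity and continuity, from the basis vectors to
    the closed subspace that they span, which is the space of vectors supported
    on the domain of [s] ([eq_hilb_hom_supported]). *)

Import Order.TTheory GRing.Theory Num.Theory numFieldNormedType.Exports.
Local Open Scope classical_set_scope.
Local Open Scope ring_scope.
Local Open Scope complex_scope.

#[local] Existing Instance summability.totally_filter.

Set Implicit Arguments.
Unset Strict Implicit.
Unset Printing Implicit Defensive.

(** * The standard basis of the space of square-summable functions *)

Lemma sum_fset1_support (T : choiceType) (V : nmodType) (x : T) (h : T -> V)
    (A : {fset T}) :
  (forall z, z != x -> h z = 0) ->
  \sum_(z <- enum_fset A) h z = if x \in A then h x else 0.
Proof.
move=> h0; case: ifPn => xA.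
  by rewrite (bigD1_seq x) ?fset_uniq//= big1 ?addr0.
rewrite big_seq big1// => z zA; apply: h0.
by apply: contra xA => /eqP <-.
Qed.

Lemma csum1_support (R : realType) (X : Type) (x : {classic X})
    (h : {classic X} -> R[i]) :
  (forall z, z != x -> h z = 0) -> csum h = h x.
Proof.
move=> h0; apply: csum_lim; apply: (@cvg_near_cst _ R[i]^o).
exists [fset x]%fset => //= A /fsubsetP xA.
by rewrite (sum_fset1_support _ h0) xA// inE.
Qed.

Lemma csum_eq0 (R : realType) (X : Type) (h : {classic X} -> R[i]) :
  (forall z, h z = 0) -> csum h = 0.
Proof.
move=> h0; apply: csum_lim; apply: (@cvg_near_cst _ R[i]^o).
by exists fset0 => //= A _; rewrite big1.
Qed.

Definition ket_fun (R : realType) (X : Type) (x : X) : X -> R[i]^o :=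
  fun z => ((z : {classic X}) == x)%:R.

Lemma ket_fun_l2 (R : realType) (X : Type) (x : X) :
  ket_fun R x \in @square_summable R X.
Proof.
apply/square_summableP; exists 1 => A.
rewrite (@sum_fset1_support _ _ (x : {classic X})).
  by case: ifP => // _; rewrite /ket_fun eqxx Normc.normc1 expr1n.
by move=> z /negbTE zx; rewrite /ket_fun zx Normc.normc0 expr0n.
Qed.

Definition ket (R : realType) (X : Type) (x : X) : l2 R X :=
  L2 (ket_fun_l2 R x).

Lemma inner_ketr (R : realType) (X : Type) (u : l2 R X) (x : X) :
  inner u (ket R x) = Num.conj (u x).
Proof.
rewrite l2_innerE (@csum1_support _ _ (x : {classic X})) /= /ket_fun.
  by rewrite eqxx mulr1.
by move=> z /negbTE zx; rewrite zx mulr0.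
Qed.

Lemma inner_ketl (R : realType) (X : Type) (u : l2 R X) (x : X) :
  inner (ket R x) u = u x.
Proof.
rewrite l2_innerE (@csum1_support _ _ (x : {classic X})) /= /ket_fun.
  by rewrite eqxx rmorph1 mul1r.
by move=> z /negbTE zx; rewrite zx rmorph0 mul0r.
Qed.

Lemma inner_disjoint (R : realType) (X : Type) (u v : l2 R X) :
  (forall x, u x = 0 \/ v x = 0) -> inner u v = 0.
Proof.
move=> uv; rewrite l2_innerE; apply: csum_eq0 => x.
by have [->|->] := uv x; rewrite ?rmorph0 ?mul0r ?mulr0.
Qed.

Lemma sum_ketE (R : realType) (X : Type) (u : l2 R X)
    (A : {fset {classic X}}) (z : {classic X}) :
  (\sum_(x <- enum_fset A) (u x : R[i]) *: ket R x) z = if z \in A then u z else 0.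
Proof.
have -> : (\sum_(x <- enum_fset A) (u x : R[i]) *: ket R x) z =
    \sum_(x <- enum_fset A) u x * ket_fun R x z.
  by elim: (enum_fset A) => [|x s IHs]; rewrite ?big_nil// !big_cons -IHs.
rewrite (@sum_fset1_support _ _ z) /ket_fun ?eqxx ?mulr1//.
by move=> x /negbTE xz; rewrite eq_sym xz mulr0.
Qed.

(** The error of a truncation to [A] is the tail of the sum of squares, which is
    small as soon as the sum over [A] is close to the supremum. *)
Lemma l2_truncation (R : realType) (X : Type) (u : l2 R X) (r : R) : 0 < r ->
  exists A : {fset {classic X}},
    `|u - \sum_(x <- enum_fset A) (u x : R[i]) *: ket R x| <= r%:C.
Proof.
move=> r0; have r20 : 0 < r ^+ 2 by rewrite exprn_gt0.
pose q (x : {classic X}) := Normc.normc (u x) ^+ 2.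
pose E := [set \sum_(x <- enum_fset A) q x | A in [set: {fset {classic X}}]].
have supE : has_sup E.
  split; first by exists (\sum_(x <- enum_fset fset0) q x); exists fset0.
  by have [M uM] := l2_bounded_sums u; exists M => _ [A _ <-].
have [_ [A _ <-]] := sup_adherent r20 supE; rewrite ltrBlDr => supA.
exists A; apply/le_l2_norm; first exact: ltW.
move=> B; set v := \sum_(x <- enum_fset A) _.
have vE (x : {classic X}) :
    Normc.normc ((u - v) x) ^+ 2 = if x \in A then 0 else q x.
  rewrite -[(u - v) x]/(u x - v x) sum_ketE.
  by case: ifP => _; rewrite ?subr0// subrr Normc.normc0 expr0n.
have q0 x : 0 <= q x by exact: sqr_ge0.
under eq_bigr do rewrite vE.
have AU : (A `<=` A `|` B)%fset by exact: fsubsetUl.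
have BU : (B `<=` A `|` B)%fset by exact: fsubsetUr.
have w0 x : 0 <= (if x \in A then 0 else q x) by case: ifP.
apply: (@le_trans _ _
    (\sum_(x <- enum_fset (A `|` B)%fset) (if x \in A then 0 else q x))).
  by rewrite (sum_fsetD _ BU) lerDl sumr_ge0.
rewrite (sum_fsetD _ AU) [X in X + _]big_seq big1 ?add0r; last first.
  by move=> x xA; rewrite ifT.
apply: (@le_trans _ _ (\sum_(x <- enum_fset ((A `|` B) `\` A)%fset) q x)).
  by apply: ler_sum => x _; case: ifP.
rewrite -(lerD2l (\sum_(x <- enum_fset A) q x)) -(sum_fsetD _ AU).
apply: le_trans (ltW supA); apply: sup_upper_bound => //.
by exists (A `|` B)%fset.
Qed.

Lemma eq_hilb_hom_supported (R : realType) (X : Type) (K : hilbertType R)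
    (D : set X) (g h : hilb_hom (l2 R X) K) (u : l2 R X) :
  (forall x, D x -> g (ket R x) = h (ket R x)) ->
  (forall x, ~ D x -> u x = 0) -> g u = h u.
Proof.
move=> gh u0; apply/eqP; rewrite -subr_eq0; apply/eqP.
(* A limit of zeros of the continuous map [g - h] is again a zero. *)
pose Z := [set v | g v - h v = 0].
have Zcl : closed Z.
  have -> : Z = (fun v => g v - h v) @^-1` [set 0] by [].
  apply: preimage_closed => [v _|]; last first.
    by apply: accessible_closed_set1; apply: hausdorff_accessible;
       exact: norm_hausdorff.
  by apply: continuousB; exact: hilb_continuous.
apply: (Zcl u) => V /nbhs_ballP[_ /posnumP[e] uV].
have /complex_gt0P[r r0 eE] : 0 < e%:num :> R[i] by [].
have [A uA] := l2_truncation u (divr_gt0 r0 (ltr0Sn R 1)).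
exists (\sum_(x <- enum_fset A) (u x : R[i]) *: ket R x); split.
  apply/eqP; rewrite subr_eq0 !linear_sum; apply/eqP/eq_bigr => x _.
  rewrite !linearZ; have [Dx|nDx] := pselect (D x); first by rewrite /= gh.
  by rewrite u0// /= !scale0r.
apply: uV; rewrite -ball_normE /= eE (le_lt_trans uA)// ltcR.
by rewrite ltr_pdivrMr// ltr_pMr// ltr1n.
Qed.

(** * Kernels and monotonicity of the induced maps *)

Lemma ker_l2_mapP (R : realType) (X Y : Type) (f : pinj X Y) (v : l2 R X) :
  hilb_ker (l2_map R f) v <-> forall x, pdom f x -> v x = 0.
Proof.
split=> [kv x|v0].
  rewrite /pdom /=; case fx : (f x) => [y|//] _.
  have : l2_map R f v y = 0 by rewrite kv.
  by rewrite /= /l2_map_fun ((pinj_invP f x y).2 fx).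
apply/val_inj/funext => y /=; rewrite /l2_map_fun.
case fy : (pinj_inv f y) => [x|//].
by apply: v0; rewrite /pdom /= ((pinj_invP f x y).1 fy).
Qed.

Lemma orthogonal_ker_l2_mapP (R : realType) (X Y : Type) (f : pinj X Y)
    (u : l2 R X) :
  orthogonal_complement (hilb_ker (l2_map R f)) u <->
  forall x, ~ pdom f x -> u x = 0.
Proof.
split=> [uf x nfx|u0 v /ker_l2_mapP v0].
  have : inner u (ket R x) = 0.
    apply: uf; apply/ker_l2_mapP => z fz /=; rewrite /ket_fun.
    by case: eqP => // zx; case: nfx; rewrite -zx.
  by rewrite inner_ketr => /eqP; rewrite conjC_eq0 => /eqP.
apply: inner_disjoint => x.
by have [fx|nfx] := pselect (pdom f x); [right; exact: v0|left; exact: u0].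
Qed.

Lemma orthogonal_ker_ket (R : realType) (X Y : Type) (f : pinj X Y) (x : X) :
  pdom f x -> orthogonal_complement (hilb_ker (l2_map R f)) (ket R x).
Proof.
move=> fx; apply/orthogonal_ker_l2_mapP => z nfz /=; rewrite /ket_fun.
by case: eqP => // zx; case: nfz; rewrite zx.
Qed.

Lemma l2_map_le (R : realType) (X Y : Type) (f g : pinj X Y) :
  pinj_le f g -> hilb_le (l2_map R f) (l2_map R g).
Proof.
move=> [dfg fg]; split=> u /orthogonal_ker_l2_mapP u0.
  by apply/orthogonal_ker_l2_mapP => x ngx; apply: u0 => /dfg.
apply/val_inj/funext => y /=; rewrite /l2_map_fun.
case fy : (pinj_inv f y) => [x|].
  have /pinj_invP fx := fy.
  have gx : g x = Some y by rewrite -fg// /pdom /= fx.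
  by rewrite ((pinj_invP g x y).2 gx).
case gy : (pinj_inv g y) => [x|//]; symmetry; apply: u0 => fx.
have /pinj_invP := gy; rewrite -fg// => /pinj_invP.
by rewrite fy.
Qed.

(** * Suprema of directed families of partial injections *)

Section DirectedUnion.
Variables (X Y I : Type) (f : I -> pinj X Y) (hf : directed pinj_le f).

Lemma pinj_leS (g h : pinj X Y) x y :
  pinj_le g h -> g x = Some y -> h x = Some y.
Proof. by move=> [_ gh] gx; rewrite -gh// /pdom /= gx. Qed.

Definition union_fun (x : X) : option Y :=
  if pselect (exists iy, f iy.1 x = Some iy.2) is left fx
  then Some (sval (cid fx)).2 else None.

(** Two members of the family that are defined at [x] agree there, because both
    lie below a third one; so the choice made in [union_fun] is immaterial. *)
Lemma union_funP x y : union_fun x = Some y <-> exists i, f i x = Some y.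
Proof.
rewrite /union_fun; case: pselect => [fx|nfx]; last first.
  by split=> // -[i fix_]; case: nfx; exists (i, y).
case: cid => -[i y'] /= fiy'; split=> [[<-]|[j fjy]]; first by exists i.
have [k [ik jk]] := hf.2 i j.
by rewrite -(pinj_leS ik fiy') (pinj_leS jk fjy).
Qed.

Lemma union_fun_inj x x' y :
  union_fun x = Some y -> union_fun x' = Some y -> x = x'.
Proof.
move=> /union_funP[i fiy] /union_funP[j fjy].
have [k [ik jk]] := hf.2 i j.
exact: pinj_inj (pinj_leS ik fiy) (pinj_leS jk fjy).
Qed.

Definition pinj_union : pinj X Y := PInj union_fun_inj.

Lemma le_pinjP (g h : pinj X Y) :
  (forall x y, g x = Some y -> h x = Some y) -> pinj_le g h.
Proof.
move=> gh; split=> x; rewrite /pdom /=; case gx : (g x) => [y|//] _;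
  by rewrite (gh _ _ gx).
Qed.

Lemma pinj_union_sup : is_sup pinj_le f pinj_union.
Proof.
split=> [i|t ft]; apply: le_pinjP => x y.
  by move=> fx; apply/union_funP; exists i.
by move=> /union_funP[j fx]; exact: pinj_leS (ft j) fx.
Qed.

(** A supremum lies below the union of the graphs, so it has no point outside
    the domains of the family. *)
Lemma sup_pdom (s : pinj X Y) (x : X) :
  is_sup pinj_le f s -> pdom s x -> exists i, pdom (f i) x.
Proof.
move=> [_ /(_ _ pinj_union_sup.1)[sU _]] /sU; rewrite /pdom /=.
case Ux : (union_fun x) => [y|//] _.
by have /union_funP[i fx] := Ux; exists i; rewrite fx.
Qed.

End DirectedUnion.

(** * Preservation of directed suprema *)

Theorem mainTheorem10 (R : realType) (X Y I : Type) (f : I -> pinj X Y)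
    (hf : directed pinj_le f) :
  (exists s : pinj X Y, is_sup pinj_le f s) /\
  (forall s : pinj X Y, is_sup pinj_le f s ->
     is_sup hilb_le (fun i => l2_map R (f i) : hilb_hom (l2 R X) (l2 R Y))
       (l2_map R s)).
Proof.
split=> [|s sup_s]; first by exists (pinj_union hf); exact: pinj_union_sup.
have fs i : hilb_le (l2_map R (f i)) (l2_map R s).
  by apply: l2_map_le; exact: sup_s.1.
split=> // t ft; split=> u /orthogonal_ker_l2_mapP u0.
  move=> v tv; apply: inner_disjoint => x.
  have [sx|nsx] := pselect (pdom s x); last by left; exact: u0.
  have [i fx] := sup_pdom hf sup_s sx.
  right; rewrite -inner_ketl.
  exact: (ft i).1 _ (orthogonal_ker_ket fx) v tv.
apply: eq_hilb_hom_supported u0 => x sx.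
have [i fx] := sup_pdom hf sup_s sx.
have kx := orthogonal_ker_ket (R := R) fx.
by rewrite -((fs i).2 _ kx) -((ft i).2 _ kx).
Qed.
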